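(* If $\langle T,\bar\mu\rangle$ is a well-pruned probability tree then, for any $n<\mathrm{ht}(T)$, $\Xi^{\bar\mu}_n$ is a probability measure on the power set $\mathcal P(\mathrm{Lv}_n(T))$.
   Context: A tree (of sequences) is a non-empty set $T$ of finite sequences with entries in some set, closed under initial segments and ordered by $s\subseteq t$ ($t$ extends $s$). $|t|$ is the length of $t$; $\mathrm{Lv}_n(T)=\{t\in T : |t|=n\}$; $\mathrm{ht}(T)=\min(\{n<\omega : \mathrm{Lv}_n(T)=\emptyset\}\cup\{\omega\})$; $\mathrm{succ}_T(t)$ is the set of $t'\in T$ extending $t$ with $|t'|=|t|+1$; $\max T$ is the set of $t\in T$ with $\mathrm{succ}_T(t)=\emptyset$. $T$ is well-pruned if, for any $t\in T$ and $|t|<n<\mathrm{ht}(T)$, there is some $t'\in\mathrm{Lv}_n(T)$ extending $t$. A probability tree is a pair $\langle T,\bar\mu\rangle$ where $T$ is a countable tree of sequences and $\bar\mu=\langle\mu_t : t\in T\smallsetminus\max T\rangle$ with each $\mu_t$ a probability measure on $\mathcal P(\mathrm{succ}_T(t))$; it is called well-pruned if $T$ is. $\Xi^{\bar\mu}$ is the ($\sigma$-additive) measure on $\mathcal P(T)$ determined by $\Xi^{\bar\mu}(\{t\})=\prod_{k<|t|}\mu_{t\upharpoonright k}(\{t\upharpoonright(k+1)\})$ for $t\in T$ (the empty product is $1$), and $\Xi^{\bar\mu}_n=\Xi^{\bar\mu}\upharpoonright\mathcal P(\mathrm{Lv}_n(T))$. *)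

(* Defs.v *)
From HB Require Import structures.
From mathcomp Require Import all_boot all_order all_algebra.
From mathcomp Require Import all_classical all_reals all_analysis.

Set Implicit Arguments.
Unset Strict Implicit.
Unset Printing Implicit Defensive.
Import Order.TTheory GRing.Theory Num.Theory.
Local Open Scope classical_set_scope.
Local Open Scope ring_scope.

(* A nonempty set [X] as a measurable space whose sigma-algebra is the whole
   power set of [X]; a measure on [discr X0] is thus a measure on P(X).
   Nonemptiness is only needed because measurable types are pointed. *)
Definition discr (U : choiceType) (X : set U) (X0 : X !=set0) : Type :=
  {x : U | x \in X}.

Section discr_instances.
Context (U : choiceType) (X : set U) (X0 : X !=set0).

HB.instance Definition _ := SubChoice.copy (discr X0) {x : U | x \in X}.

Let discr_point : discr X0 :=
  let: exist x Xx := cid X0 in exist _ x (mem_set Xx).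

HB.instance Definition _ := isPointed.Build (discr X0) discr_point.

HB.instance Definition _ := @isMeasurable.Build default_measure_display
  (discr X0) discrete_measurable discrete_measurable0
  discrete_measurableC discrete_measurableU.

Definition elt (x : U) (Xx : X x) : discr X0 := exist _ x (mem_set Xx).

End discr_instances.

Section trees.
Context (A : choiceType).
Implicit Types (T : set (seq A)) (s t : seq A) (n : nat).

Definition is_tree T :=
  T !=set0 /\ forall s t, T t -> prefix s t -> T s.

Definition Lv T n : set (seq A) := [set t | T t /\ size t = n].

Definition succ T t : set (seq A) :=
  [set t' | [/\ T t', prefix t t' & size t' = (size t).+1]].

Definition maxT T : set (seq A) := [set t | T t /\ succ T t = set0].

(* Heights live in omega + 1, with [None] standing for omega. *)
Definition ht T : option nat :=
  if pselect (exists n, `[< Lv T n = set0 >]) is left h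
  then Some (ex_minn h) else None.

Definition lt_height n (h : option nat) : Prop :=
  if h is Some m then (n < m)%N else True.

Definition well_pruned T := forall t n, T t -> (size t < n)%N ->
  lt_height n (ht T) -> exists2 t', Lv T n t' & prefix t t'.

Lemma Lv_neq0 T n : lt_height n (ht T) -> Lv T n !=set0.
Proof.
move=> nT; apply/set0P/eqP => Ln0; move: nT; rewrite /lt_height /ht.
case: pselect => [h|[]]; last by exists n; apply/asboolP.
by case: ex_minnP => m _ /(_ n (asboolT Ln0)); rewrite ltnNge => ->.
Qed.

Lemma succ_neq0 T t : (T `\` maxT T) t -> succ T t !=set0.
Proof. by move=> [Tt Mt]; apply/set0P/eqP => St0; apply: Mt. Qed.

Lemma take_succ T t (k : 'I_(size t)) : is_tree T -> T t ->
  succ T (take k t) (take k.+1 t).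
Proof.
move=> [_ clT] Tt; have kt := ltn_ord k; split.
- by apply: clT Tt _; rewrite prefixE size_takel// take_takel.
- by rewrite prefixE size_takel ?(ltnW kt)// take_takel.
- by rewrite !size_takel// ltnW.
Qed.

Lemma take_nonmax T t (k : 'I_(size t)) : is_tree T -> T t ->
  (T `\` maxT T) (take k t).
Proof.
move=> hT Tt; split; last first.
  by move=> [_ S0]; have := take_succ k hT Tt; rewrite S0.
case: hT => _ clT; apply: clT Tt _.
by rewrite prefixE size_takel// ltnW.
Qed.

End trees.

Record prob_tree (R : realType) (A : choiceType) := ProbTree {
  pt_tree : set (seq A) ;
  pt_is_tree : is_tree pt_tree ;
  pt_countable : countable pt_tree ;
  pt_mu : forall t (Tt : (pt_tree `\` maxT pt_tree) t),
    probability (discr (succ_neq0 Tt)) R }.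

Section Xi.
Context (R : realType) (A : choiceType) (p : prob_tree R A).
Local Open Scope ereal_scope.
Local Notation T := (pt_tree p).

Local Notation pt_space := (discr (proj1 (pt_is_tree p))).

Definition Xi_weight (t : pt_space) : \bar R :=
  \prod_(k < size (val t))
    pt_mu (take_nonmax k (pt_is_tree p) (set_mem (valP t)))
      [set elt _ (take_succ k (pt_is_tree p) (set_mem (valP t)))].

Definition Xi (B : set pt_space) : \bar R := \esum_(t in B) Xi_weight t.

Lemma Xi_weight_ge0 t : 0 <= Xi_weight t.
Proof. by apply: prode_ge0 => k _; exact: measure_ge0. Qed.

Let Xi0 : Xi set0 = 0. Proof. exact: esum_set0. Qed.

Let Xi_ge0 B : 0 <= Xi B.
Proof. by apply: esum_ge0 => t _; exact: Xi_weight_ge0. Qed.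

Let Xi_sigma_additive : semi_sigma_additive Xi.
Proof.
move=> F _ tF _; rewrite /Xi esum_bigcupT//; last exact: Xi_weight_ge0.
rewrite -nneseries_esumT; last by move=> n; exact: Xi_ge0.
by apply: is_cvg_nneseries => n _ _; exact: Xi_ge0.
Qed.

HB.instance Definition _ := isMeasure.Build _ _ _ Xi Xi0 Xi_ge0
  Xi_sigma_additive.

Lemma Xi_set1 t : Xi [set t] = Xi_weight t.
Proof. by rewrite /Xi esum_set1//; exact: Xi_weight_ge0. Qed.

(* [Xi_set1] and [Xi_unique]: [Xi] is the measure on P(T) determined by its
   values on singletons. *)
Lemma Xi_unique (m : {measure set pt_space -> \bar R}) :
  (forall t, m [set t] = Xi_weight t) -> forall B, m B = Xi B.
Proof.
move=> m1 B.
have /countable_injP[f finj] := pt_countable p.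
pose F n : set pt_space := B `&` [set t | f (val t) = n].
have BF : B = \bigcup_n F n.
  by apply/seteqP; split=> [t Bt|t [n _ []]//]; exists (f (val t)).
have F1 n (s t : pt_space) : F n s -> F n t -> s = t.
  move=> [_ <-] [_ /esym fst]; apply/val_inj/finj => //; exact: valP.
have tF : trivIset setT F by move=> i j _ _ [t [[_ <-] [_ <-]]].
rewrite BF !measure_bigcup//; apply: eq_eseriesr => n _ /=.
have [->|/set0P[t Ft]] := eqVneq (F n) set0; first by rewrite !measure0.
have -> : F n = [set t].
  by apply/seteqP; split=> [s Fs|s ->//]; exact: (F1 n).
by rewrite m1 Xi_set1.
Qed.

(* A subset [B] of [Lv T n] is viewed as a subset of [T]. *)
Definition Xi_level n (hn : lt_height n (ht T)) :
    set (discr (Lv_neq0 hn)) -> \bar R :=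
  fun B => Xi [set t | (val @` B) (val t)].

End Xi.

(* Main.v *)
Require Import Defs.
From HB Require Import structures.
From mathcomp Require Import all_boot all_order all_algebra.
From mathcomp Require Import all_classical all_reals all_analysis.

(* Write W s for the product of the transition probabilities along s.  Level
   n + 1 is the disjoint union of the sets succ t for t in level n, and the
   masses in succ t add up to W t, because pt_mu is a probability there;
   well-prunedness guarantees that no t of level n is maximal.  So the total
   mass of a level does not depend on n, and it is 1 at the root. *)

Import Order.TTheory GRing.Theory Num.Theory.
Local Open Scope classical_set_scope.
Local Open Scope ring_scope.
Local Open Scope ereal_scope.

(** Multiplication by a nonnegative real commutes with each finite partial sum and with their
    supremum. *)
Lemma ge0_esumZl (R : realType) (T : choiceType) (I : set T) (a : T -> \bar R)
    (r : R) :
  (0 <= r)%R -> (forall i, I i -> 0 <= a i) ->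
  \esum_(i in I) (r%:E * a i) = r%:E * \esum_(i in I) a i.
Proof.
move=> r0 a0; rewrite /esum -ereal_supZl//; last first.
  by apply/set0P; exists (\sum_(x \in set0) a x), set0 => //; exact: fsets_set0.
congr ereal_sup; rewrite image_comp; apply: eq_imagel => X [finX XI] /=.
have a0' i : X i -> 0 <= (if i \in X then a i else 0).
  by move=> Xi; rewrite mem_set//; apply/a0/XI.
(* [a] is known to be nonnegative only on [I], while [ge0_mule_fsumr] wants a function that is
   nonnegative everywhere; hence the cut-off to 0 outside [X]. *)
rewrite (eq_fsbigr (fun i => r%:E * (if i \in X then a i else 0))); last first.
  by move=> i ->.
rewrite -ge0_mule_fsumr//; last first.
  by move=> i; case: ifPn => // /set_mem /XI; exact: a0.
by congr (_ * _); apply: eq_fsbigr => i ->.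
Qed.

(** The iterated sum runs over the pairs [(k, x)] with [x] in [J k]; disjointness makes the second
    projection a bijection from these pairs onto the union. *)
Lemma esum_partition (R : realType) (I T : choiceType) (K : set I)
    (J : I -> set T) (a : T -> \bar R) :
  trivIset K J -> (forall x, 0 <= a x) ->
  \esum_(x in \bigcup_(k in K) J k) a x = \esum_(k in K) \esum_(x in J k) a x.
Proof.
move=> tJ a0; rewrite esum_esum//; apply: reindex_esum; split.
- by move=> [k x] [Kk Jx]; exists k.
- move=> [k x] [k' x'] /set_mem[/= Kk Jx] /set_mem[/= Kk' Jx'] xx'.
  by rewrite (tJ k k')// ?xx'//; exists x; split=> //; rewrite xx'.
- by move=> x [k Kk Jx]; exists (k, x).
Qed.

(** An injection of [X] into the naturals cuts [B] into countably many fibres, each empty or a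
    single point, so sigma-additivity applies. *)
Lemma discr_measureE (R : realType) (U : choiceType) (X : set U)
    (X0 : X !=set0) (m : {measure set (discr X0) -> \bar R})
    (B : set (discr X0)) :
  countable X -> m B = \esum_(x in B) m [set x].
Proof.
move=> /countable_injP[f finj].
pose F n : set (discr X0) := B `&` [set x | f (val x) = n].
have BF : B = \bigcup_n F n.
  by apply/seteqP; split=> [x Bx|x [n _ []]//]; exists (f (val x)).
have tF : trivIset setT F by move=> i j _ _ [x [[_ <-] [_ <-]]].
rewrite BF measure_bigcup// esum_bigcupT//.
rewrite nneseries_esum// set_mem_set; apply: eq_esum => n _.
have [->|/set0P[x Fx]] := eqVneq (F n) set0; first by rewrite measure0 esum_set0.
suff -> : F n = [set x] by rewrite esum_set1.
apply/seteqP; split=> [y [_ fy]|y ->//].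
case: Fx => _ fx; apply/val_inj/finj; [exact: valP|exact: valP|].
by rewrite [LHS]fy -fx.
Qed.

Section level_mass.
Context {R : realType} {A : choiceType} (p : prob_tree R A).
Local Notation T := (pt_tree p).
Implicit Types s t : seq A.

(* Extended by the junk value 0 outside of the relation [s \in succ T t], so as
   to avoid the dependency of [pt_mu] on membership proofs. *)
Definition transition t s : \bar R :=
  if pselect ((T `\` maxT T) t) is left Tt then
    if pselect (succ T t s) is left ts then
      pt_mu Tt [set elt (succ_neq0 Tt) ts] else 0
  else 0.

Definition path_weight s : \bar R :=
  \prod_(k < size s) transition (take k s) (take k.+1 s).

(** Proof irrelevance: the value does not depend on which membership proofs [pselect] returns. *)
Lemma transitionE t s (Tt : (T `\` maxT T) t) (ts : succ T t s) :
  transition t s = pt_mu Tt [set elt (succ_neq0 Tt) ts].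
Proof.
rewrite /transition; case: pselect => // Tt'; case: pselect => // ts'.
by rewrite (Prop_irrelevance Tt' Tt) (Prop_irrelevance ts' ts).
Qed.

Lemma transition_ge0 t s : 0 <= transition t s.
Proof. by rewrite /transition; case: pselect => // ?; case: pselect. Qed.

Lemma transition_fin_num t s : transition t s \is a fin_num.
Proof.
rewrite /transition; case: pselect => // Tt; case: pselect => // ts.
exact: fin_num_measure.
Qed.

Lemma path_weight_ge0 s : 0 <= path_weight s.
Proof. by apply: prode_ge0 => k _; exact: transition_ge0. Qed.

Lemma path_weight_fin_num s : path_weight s \is a fin_num.
Proof. by apply: prode_fin_num => k _; exact: transition_fin_num. Qed.

Lemma path_weight_succ t s : succ T t s ->
  path_weight s = path_weight t * transition t s.
Proof.
move=> [_ /prefixP[u ->]]; rewrite size_cat -addn1 => /eqP.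
rewrite eqn_add2l => /eqP u1.
rewrite /path_weight size_cat u1 addn1 big_ord_recr/=; congr (_ * _).
  apply: eq_bigr => k _; rewrite !takel_cat//.
  exact: ltnW.
(* In the last factor, [k = size t]: the first truncation is [t] and the second is the whole
   sequence. *)
by rewrite take_size_cat// take_oversize// size_cat u1 addn1.
Qed.

Lemma esum_transition t : (T `\` maxT T) t ->
  \esum_(s in succ T t) transition t s = 1.
Proof.
move=> Tt.
have -> : succ T t = val @` [set: discr (succ_neq0 Tt)].
  apply/seteqP; split=> [s ts|s [x _ <-]]; last exact: set_mem (valP x).
  by exists (elt (succ_neq0 Tt) ts).
rewrite esum_image; last by move=> x y _ _; exact: val_inj.
rewrite -(probability_setT (pt_mu Tt)) discr_measureE; last first.
  (* [succ T t] inherits countability from [T]. *)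
  by apply: sub_countable (pt_countable p); apply: subset_card_le => s [].
apply: eq_esum => x _; rewrite (transitionE _ _ Tt (set_mem (valP x))).
by congr (pt_mu Tt [set _]); exact: val_inj.
Qed.

Lemma Xi_weightE (t : discr (proj1 (pt_is_tree p))) :
  Xi_weight t = path_weight (val t).
Proof. by apply: eq_bigr => k _; apply/esym/transitionE. Qed.

Lemma XiE (B : set (discr (proj1 (pt_is_tree p)))) :
  Xi B = \esum_(s in val @` B) path_weight s.
Proof.
rewrite esum_image; last by move=> x y _ _; exact: val_inj.
by apply: eq_esum => t _; exact: Xi_weightE.
Qed.

Lemma Lv0 : Lv T 0 = [set [::]].
Proof.
apply/seteqP; split=> [s [_ /size0nil]//|_ ->]; split=> //.
by have [[s Ts] clT] := pt_is_tree p; exact: clT Ts (prefix0s s).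
Qed.

Lemma LvS n : Lv T n.+1 = \bigcup_(t in Lv T n) succ T t.
Proof.
apply/seteqP; split=> [s [Ts sn]|s [t [_ <-] []]//].
have ns : (n <= size s)%N by rewrite sn.
have sz : size (take n s) = n by rewrite size_takel.
have pr : prefix (take n s) s by rewrite prefixE sz.
exists (take n s); last by split=> //; rewrite sz.
by split=> //; have [_ clT] := pt_is_tree p; exact: clT Ts pr.
Qed.

(** A successor determines its parent, by dropping its last entry. *)
Lemma trivIset_succ (D : set (seq A)) : trivIset D (succ T).
Proof.
move=> t t' _ _ [s [[_ ts st] [_ ts' st']]].
move: ts ts'; rewrite !prefixE => /eqP <- /eqP <-.
by move: st; rewrite st' => -[->].
Qed.

Lemma nonmax_Lv n t : well_pruned T -> lt_height n.+1 (ht T) -> Lv T n t ->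
  (T `\` maxT T) t.
Proof.
move=> wp hn [Tt tn]; split=> // -[_ S0].
have [|s [Ts sn] ts] := wp t n.+1 Tt _ hn; first by rewrite tn.
by have : succ T t s by [split=> //; rewrite sn tn]; rewrite S0.
Qed.

Lemma esum_Lv n : well_pruned T -> lt_height n (ht T) ->
  \esum_(s in Lv T n) path_weight s = 1.
Proof.
move=> wp; elim: n => [_|n IH hn].
  by rewrite Lv0 esum_set1 ?path_weight_ge0// /path_weight big_ord0.
have hn' : lt_height n (ht T).
  by move: hn; rewrite /lt_height; case: (ht T) => // m; exact: ltnW.
rewrite LvS esum_partition; [|exact: trivIset_succ|exact: path_weight_ge0].
rewrite -(IH hn'); apply: eq_esum => t Lt.
(* The weight of [t] is finite, so it can be written as a real and pulled out of the sum over
   [succ T t]. *)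
rewrite (eq_esum (path_weight_succ t)) -(fineK (path_weight_fin_num t)).
rewrite ge0_esumZl ?fine_ge0 ?path_weight_ge0//; last first.
  by move=> s _; exact: transition_ge0.
by rewrite esum_transition ?mule1//; exact: nonmax_Lv hn Lt.
Qed.

Variables (n : nat) (hn : lt_height n (ht T)).

(** Level [n] and the tree are distinct subtypes; taking images under [val] brings both to sums over
    plain sequences. *)
Lemma Xi_levelE (B : set (discr (Lv_neq0 hn))) :
  Xi_level B = \esum_(s in val @` B) path_weight s.
Proof.
rewrite /Xi_level XiE; congr (esum _ _); apply/seteqP.
split=> [s [t Bt <-]//|s [x Bx <-]].
have [Tx _] : Lv T n (val x) := set_mem (valP x).
by exists (elt (proj1 (pt_is_tree p)) Tx) => //; exists x.
Qed.

Let Xi_level0 : Xi_level (set0 : set (discr (Lv_neq0 hn))) = 0.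
Proof. by rewrite Xi_levelE image_set0 esum_set0. Qed.

Let Xi_level_ge0 (B : set (discr (Lv_neq0 hn))) : 0 <= Xi_level B.
Proof. by apply: esum_ge0 => t _; exact: Xi_weight_ge0. Qed.

Let Xi_level_sigma_additive : semi_sigma_additive (@Xi_level R A p n hn).
Proof.
move=> F _ tF _; rewrite Xi_levelE image_bigcup esum_partition//; last first.
- exact: path_weight_ge0.
(* The images of the disjoint sets [F i] stay disjoint because [val] is injective. *)
- move=> i j _ _ [s [[x Fx <-] [y Fy /val_inj yx]]].
  by apply: tF => //; exists x; split; rewrite // -yx.
under eq_esum do rewrite -Xi_levelE.
by rewrite -nneseries_esumT//; exact: is_cvg_nneseries.
Qed.

HB.instance Definition _ := isMeasure.Build _ _ _
  (@Xi_level R A p n hn) Xi_level0 Xi_level_ge0 Xi_level_sigma_additive.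

Lemma Xi_level_setT : well_pruned T -> Xi_level [set: discr (Lv_neq0 hn)] = 1.
Proof.
move=> wp; rewrite Xi_levelE -(esum_Lv n wp hn); congr (esum _ _).
apply/seteqP; split=> [_ [x _ <-]|s Ls]; first exact: set_mem (valP x).
by exists (elt (Lv_neq0 hn) Ls).
Qed.

End level_mass.

Theorem theorem4p10 (R : realType) (A : choiceType) (p : prob_tree R A) :
  well_pruned (pt_tree p) ->
  forall (n : nat) (hn : lt_height n (ht (pt_tree p))),
  exists P : probability (discr (Lv_neq0 hn)) R,
    forall B : set (discr (Lv_neq0 hn)), P B = Xi_level B.
Proof.
move=> wp n hn.
pose mu : {measure set (discr (Lv_neq0 hn)) -> \bar R} := @Xi_level R A p n hn.
(* Total mass 1 turns the measure [mu] into a probability with the same underlying function. *)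
pose muT := Measure_isProbability.Build _ _ _ mu (Xi_level_setT p n hn wp).
pose P : probability (discr (Lv_neq0 hn)) R := HB.pack (Measure.sort mu) muT.
by exists P.
Qed.
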